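(* Let $\triangle$ be a hyperbolic $n$-simplex in $H^n$ with vertices $p_1,\dots,p_{n+1}$ and edge matrix $M$, let $0\le k\le n-1$, let $W=\mathrm{span}\{p_1,\dots,p_{k+1}\}\subset R_1^{n+1}$, and let $W^h=W\cap H^n$ be the $k$-plane containing the $k$-face of $\triangle$ with vertices $p_1,\dots,p_{k+1}$. Let $p$ be a point of $H^n$. Then $$ \cosh \xi(p,W^h)=\sqrt{1-\sum_{s,t=k+2}^{n+1}\frac{\sqrt{M_{ss}M_{tt}}\; m_{t}^{s}\,\langle p,e_t\rangle\langle p,e_s\rangle}{|M|\,m^{k+1}}}, $$ where $\xi(p,W^h)$ is the distance between $p$ and $W^h$.
   Context: $R_1^{n+1}$ is $\mathbb{R}^{n+1}$ with the scalar product $\langle x,y\rangle=-x_1y_1+\sum_{i=2}^{n+1}x_iy_i$, and $H^n=\{x\in R_1^{n+1}: \langle x,x\rangle=-1,\ x_1>0\}$ is hyperbolic $n$-space with distance $\operatorname{arccosh}(-\langle p,q\rangle)$. A $k$-plane of $H^n$ is the intersection of $H^n$ with a $(k+1)$-dimensional time-like subspace (one containing a vector $v$ with $\langle v,v\rangle<0$). A hyperbolic $n$-simplex $\triangle$ has vertices $p_1,\dots,p_{n+1}\in H^n$ that are linearly independent in $R_1^{n+1}$. The edge matrix of $\triangle$ is $M=[\langle p_i,p_j\rangle]_{i,j=1,\dots,n+1}$; $|M|$ is its determinant and $M_{ij}$ is its $(i,j)$ cofactor (signed minor); so $M_{ii}$ is the determinant of $M$ with row and column $i$ deleted. The unit outer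 normal of the face opposite $p_i$ is $$e_i=\frac{\sum_{j=1}^{n+1}M_{ij}p_j}{\sqrt{M_{ii}|M|}},\qquad i=1,\dots,n+1.$$ $m^{k+1}$ is the determinant of the submatrix of $M$ with rows and columns $1,\dots,k+1$. For $i,j\in\{k+2,\dots,n+1\}$, $m_i^j$ is the determinant of the submatrix of $M$ with rows $1,\dots,k+1,i$ and columns $1,\dots,k+1,j$. The perpendicular foot of $p$ on a $k$-plane is the point where the geodesic through $p$ meeting the $k$-plane orthogonally intersects the $k$-plane (it is $p$ itself if $p$ lies in the $k$-plane). The distance between $p$ and the $k$-plane is the length of the geodesic segment joining $p$ to its perpendicular foot. *)

(* Defs.v *)
From mathcomp Require Import all_boot all_order all_algebra.
From mathcomp Require Import all_classical all_reals all_analysis.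
Set Implicit Arguments.
Unset Strict Implicit.
Unset Printing Implicit Defensive.
Import Order.TTheory GRing.Theory Num.Theory.
Local Open Scope classical_set_scope.
Local Open Scope ring_scope.

Section HyperbolicFunctions.
Variable R : realType.

Definition cosh (x : R) : R := (expR x + expR (- x)) / 2.

Definition arccosh (x : R) : R := ln (x + Num.sqrt (x ^+ 2 - 1)).

End HyperbolicFunctions.

(* Indices are shifted by one: 1, ..., n+1 become the ordinals 0, ..., n,
   so ord0 is the time-like coordinate. *)
Section HyperbolicSpace.
Variables (R : realType) (n : nat).
Local Notation V := 'rV[R]_n.+1.

Definition lorentz (x y : V) : R :=
  - (x 0 ord0 * y 0 ord0) + \sum_(i < n.+1 | i != ord0) x 0 i * y 0 i.

Definition hyperbolic_space : set V :=
  [set x | lorentz x x = -1 /\ 0 < x 0 ord0].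

Definition hdist (p q : V) : R := arccosh (- lorentz p q).

Definition time_like (U : {vspace V}) : Prop :=
  exists2 v, v \in U & lorentz v v < 0.

(* A k-plane is [hplane U] with [U] time-like and [\dim U = k.+1]; it is
   handled through [U].  Geodesics are the 1-planes. *)
Definition hplane (U : {vspace V}) : set V :=
  hyperbolic_space `&` [set x | x \in U].

(* The tangent space at q of [hplane U], inside the ambient linear space *)
Definition tangent (U : {vspace V}) (q : V) : set V :=
  [set u | u \in U /\ lorentz u q = 0].

Definition orthogonal_at (U W : {vspace V}) (q : V) : Prop :=
  [/\ hplane U q, hplane W q &
      forall u w, tangent U q u -> tangent W q w -> lorentz u w = 0].

Definition is_perp_foot (W : {vspace V}) (p q : V) : Prop :=
  (hplane W p /\ q = p) \/
  (~ hplane W p /\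
   exists L : {vspace V},
     [/\ \dim L = 2, time_like L, hplane L p & orthogonal_at L W q]).

(* The default value p of [xget] is irrelevant: a point of the hyperbolic
   space has exactly one foot on a k-plane. *)
Definition perp_foot (W : {vspace V}) (p : V) : V :=
  xget p [set q | is_perp_foot W p q].

Definition dist_plane (p : V) (W : {vspace V}) : R := hdist p (perp_foot W p).

Definition hsimplex (p : 'I_n.+1 -> V) : Prop :=
  (forall i, hyperbolic_space (p i)) /\ row_free (\matrix_(i < n.+1) p i).

Definition edge_matrix (p : 'I_n.+1 -> V) : 'M[R]_n.+1 :=
  \matrix_(i, j) lorentz (p i) (p j).

Definition outer_normal (p : 'I_n.+1 -> V) (i : 'I_n.+1) : V :=
  let M := edge_matrix p in
  (Num.sqrt (cofactor M i i * \det M))^-1 *: \sum_j cofactor M i j *: p j.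

Definition face_span (p : 'I_n.+1 -> V) (k : nat) : {vspace V} :=
  (\sum_(i < n.+1 | (i <= k)%N) <[p i]>)%VS.

(* m^{k+1}; meaningful for k <= n, where [inord a] has value a *)
Definition leading_minor (M : 'M[R]_n.+1) (k : nat) : R :=
  \det (\matrix_(a < k.+1, b < k.+1) M (inord a) (inord b)).

(* [border i] enumerates the indices 0, ..., k, i. *)
Definition border (k : nat) (i : 'I_n.+1) (a : 'I_k.+2) : 'I_n.+1 :=
  if (a <= k)%N then inord a else i.

(* m_i^j *)
Definition bordered_minor (M : 'M[R]_n.+1) (k : nat) (i j : 'I_n.+1) : R :=
  \det (\matrix_(a < k.+2, b < k.+2) M (border i a) (border j b)).

End HyperbolicSpace.

(* Main.v *)
Require Import Defs.
From mathcomp Require Import all_boot all_order all_algebra.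
From mathcomp Require Import all_classical all_reals all_analysis.
From mathcomp Require Import ring lra.
Import Order.TTheory GRing.Theory Num.Theory.
Local Open Scope ring_scope.

(** Split [p] orthogonally along [W]: [p = g + h] with [g] in [W] and [h]
    orthogonal to [W].  The foot of [p] on the plane cut out by [W] is [g] scaled
    to the hyperboloid, so [cosh] of the distance is the square root of
    [- lorentz g g = 1 + lorentz h h = 1 + lorentz p h] ([cosh_dist_plane]).
    Existence of the foot and the value of the distance both rest on one fact
    about the signature: a nonzero vector orthogonal to a time-like vector is
    space-like ([lorentz_orthogonal_gt0]).

    It remains to compute [lorentz p h] from the vertices.  The vectors
    [d_s = \sum_j M_sj p_j], of which the outer normals are multiples, satisfy
    [lorentz d_s p_i = |M|] if [i = s] and [0] otherwise, so the coordinates of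
    [p] in the basis of vertices are [x_s = lorentz d_s p / |M|].  Moreover
    [lorentz d_s d_s = M_ss |M|], and this is positive because [d_s] is
    orthogonal to the other vertices, which are time-like.

    Let [h_t] be the part of [p_t] orthogonal to [W].  Then [h] is the sum of the
    [x_t h_t] over the vertices outside the face, and
    [lorentz p h = \sum_(s, t) x_s x_t lorentz h_t p_s].  Replacing [p_t] by
    [h_t] in the last row of the bordered minor does not change the determinant
    and kills all of that row but one entry, whence
    [m_t^s = m^{k+1} lorentz h_t p_s] ([bordered_minor_proj]).  The minus sign in
    front of the sum comes from [|M| < 0], which turns
    [sqrt (M_ss |M|) * sqrt (M_tt |M|)] into [- |M| * sqrt (M_ss M_tt)]. *)

(** * The Lorentz form *)

Section Lorentz.
Variables (R : realType) (n : nat).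
Local Notation V := 'rV[R]_n.+1.
Implicit Types (x y z p q u w h : V) (W L : {vspace V}).

Lemma lorentzC x y : lorentz x y = lorentz y x.
Proof.
rewrite /lorentz mulrC; congr (_ + _); apply: eq_bigr => i _; exact: mulrC.
Qed.

Lemma lorentzDl x y z : lorentz (x + y) z = lorentz x z + lorentz y z.
Proof.
rewrite /lorentz addrACA -big_split /= !mxE mulrDl opprD; congr (_ + _).
by apply: eq_bigr => i _; rewrite !mxE mulrDl.
Qed.

Lemma lorentzZl a x z : lorentz (a *: x) z = a * lorentz x z.
Proof.
rewrite /lorentz mulrDr big_distrr /= !mxE -mulrA mulrN; congr (_ + _).
by apply: eq_bigr => i _; rewrite !mxE mulrA.
Qed.

Lemma lorentzDr x y z : lorentz z (x + y) = lorentz z x + lorentz z y.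
Proof. by rewrite lorentzC lorentzDl !(lorentzC z). Qed.

Lemma lorentzZr a x z : lorentz z (a *: x) = a * lorentz z x.
Proof. by rewrite lorentzC lorentzZl (lorentzC z). Qed.

Lemma lorentzBl x y z : lorentz (x - y) z = lorentz x z - lorentz y z.
Proof. by rewrite lorentzDl -scaleN1r lorentzZl mulN1r. Qed.

Lemma lorentzBr x y z : lorentz z (x - y) = lorentz z x - lorentz z y.
Proof. by rewrite lorentzC lorentzBl !(lorentzC z). Qed.

Lemma lorentz0l x : lorentz 0 x = 0.
Proof. by rewrite -(scale0r 0) lorentzZl mul0r. Qed.

Lemma lorentz_suml (I : finType) (P : pred I) (F : I -> V) x :
  lorentz (\sum_(i | P i) F i) x = \sum_(i | P i) lorentz (F i) x.
Proof.
by apply: (big_morph (fun u => lorentz u x)) => [u w|];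
  rewrite (lorentzDl, lorentz0l).
Qed.

Lemma lorentz_sumr (I : finType) (P : pred I) (F : I -> V) x :
  lorentz x (\sum_(i | P i) F i) = \sum_(i | P i) lorentz x (F i).
Proof. by rewrite lorentzC lorentz_suml; apply: eq_bigr => i _; exact: lorentzC. Qed.

Lemma lorentz_time0_gt0 x : x 0 ord0 = 0 -> x != 0 -> 0 < lorentz x x.
Proof.
move=> x0; rewrite ltNge; apply: contra_neqN; rewrite /lorentz x0 mul0r oppr0 add0r => le0.
have /eqP : \sum_(i < n.+1 | i != ord0) x 0 i * x 0 i = 0.
  by apply/eqP; rewrite eq_le le0 sumr_ge0 // => i _; rewrite -expr2 sqr_ge0.
rewrite psumr_eq0 => [/allP xi0|i _]; last by rewrite -expr2 sqr_ge0.
apply/rowP => i; rewrite mxE; have [->|i_neq0] := eqVneq i ord0; first exact: x0.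
have := xi0 i (mem_index_enum i).
by rewrite i_neq0 /= mulf_eq0 orbb => /eqP.
Qed.

Lemma lorentz_time0_ge0 x : x 0 ord0 = 0 -> 0 <= lorentz x x.
Proof.
move=> x0; have [->|xN0] := eqVneq x 0; first by rewrite lorentz0l.
by rewrite ltW // lorentz_time0_gt0.
Qed.

Lemma time_like_time_neq0 q : lorentz q q < 0 -> q 0 ord0 != 0.
Proof.
by move=> q_neg; apply/eqP => /lorentz_time0_ge0; rewrite leNgt q_neg.
Qed.

(** The combination [q_0 u - u_0 q] has no time coordinate, so its square is
    nonnegative; when [u] and [q] are orthogonal that square is
    [q_0^2 lorentz u u + u_0^2 lorentz q q], whose second term is at most [0]. *)
Lemma lorentz_orthogonal_gt0 q u :
  lorentz q q < 0 -> lorentz u q = 0 -> u != 0 -> 0 < lorentz u u.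
Proof.
move=> q_neg uq0; rewrite ltNge; apply: contra_neqN => u_le0.
have q0N0 := time_like_time_neq0 _ q_neg.
set y := q 0 ord0 *: u - u 0 ord0 *: q.
have y0 : y 0 ord0 = 0 by rewrite !mxE mulrC subrr.
have yyE : lorentz y y =
    q 0 ord0 ^+ 2 * lorentz u u + u 0 ord0 ^+ 2 * lorentz q q.
  rewrite /y !(lorentzBl, lorentzBr, lorentzZl, lorentzZr) (lorentzC q u) uq0.
  by ring.
have yy_ge0 := lorentz_time0_ge0 _ y0.
have u0 : u 0 ord0 = 0.
  apply/eqP; rewrite -sqrf_eq0; apply: contraTT yy_ge0 => u0N0.
  rewrite -ltNge yyE -[ltRHS]addr0 ler_ltD ?mulr_ge0_le0 ?sqr_ge0 //.
  by rewrite pmulr_rlt0 // lt0r u0N0 sqr_ge0.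
apply/eqP; apply: contraTT u_le0 => uN0.
by rewrite -ltNge lorentz_time0_gt0.
Qed.

(** Reversed Cauchy-Schwarz inequality, from the square of the time-free vector
    [q_0 p - p_0 q]: it makes [- lorentz p q] a legitimate value of [cosh]. *)
Lemma lorentz_hyperbolic_le p q :
  hyperbolic_space p -> hyperbolic_space q -> lorentz p q <= -1.
Proof.
move=> [pp p0] [qq q0].
set y := q 0 ord0 *: p - p 0 ord0 *: q.
have : 0 <= lorentz y y by apply: lorentz_time0_ge0; rewrite !mxE mulrC subrr.
rewrite /y !(lorentzBl, lorentzBr, lorentzZl, lorentzZr) (lorentzC q p) pp qq.
have := mulr_gt0 p0 q0; set c := p 0 _ in p0 *; set d := q 0 _ in q0 *.
move=> cd_gt0 yy_ge0.
rewrite -(ler_pM2l cd_gt0).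
by have := sqr_ge0 (c - d); nra.
Qed.

(** Were [q] on the lower sheet, the reversed Cauchy-Schwarz inequality for [p]
    and [- q] would give [1 <= lorentz p q]. *)
Lemma hyperbolic_space_orientation p q : hyperbolic_space p ->
  lorentz q q = -1 -> lorentz p q < 0 -> hyperbolic_space q.
Proof.
move=> hp qq pq; split=> //.
have := time_like_time_neq0 q; rewrite qq ltrN10 => /(_ isT).
rewrite neq_lt => /orP[q0|q0]; last by [].
have hNq : hyperbolic_space ((-1) *: q).
  by split; rewrite ?lorentzZl ?lorentzZr ?qq ?mxE ?mulN1r ?opprK ?oppr_gt0.
by have := lorentz_hyperbolic_le _ _ hp hNq; rewrite lorentzZr; lra.
Qed.

(** * Perpendicular feet and the distance to a plane *)

Lemma arccoshK (c : R) : 1 <= c -> cosh (arccosh c) = c.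
Proof.
move=> c1; rewrite /cosh /arccosh expRN.
have r_ge0 : 0 <= c ^+ 2 - 1 by rewrite subr_ge0 expr_ge1 //; lra.
set r := Num.sqrt _; have r0 : 0 <= r by exact: sqrtr_ge0.
have rr : r ^+ 2 = c ^+ 2 - 1 by rewrite sqr_sqrtr.
rewrite lnK ?posrE; last lra.
have -> : (c + r)^-1 = c - r.
  have cr : c + r != 0 by apply/eqP; lra.
  apply: (mulfI cr); rewrite divff //.
  by rewrite mulrC -subr_sqr rr; ring.
by field.
Qed.

Definition orthogonal_to W h := forall w, w \in W -> lorentz h w = 0.

(** The vector [p + lorentz p q *: q] is the tangent part of [p] at [q].
    Perpendicularity of the geodesic makes it orthogonal to the tangent space of
    the plane at [q]; being orthogonal to [q] as well, it is orthogonal to all of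
    [W]. *)
Lemma perp_foot_orthogonal W p q : hyperbolic_space p ->
  is_perp_foot W p q ->
  hplane W q /\ orthogonal_to W (p + lorentz p q *: q).
Proof.
move=> [pp _] [[Wp ->]|[_ [L [_ _ [_ Lp] [[hq Lq] [_ Wq] orthLW]]]]].
  by split=> // w _; rewrite pp scaleN1r subrr lorentz0l.
split=> // w Ww; have qq : lorentz q q = -1 by case: hq.
set h := p + _.
have hq0 : lorentz h q = 0 by rewrite lorentzDl lorentzZl qq mulrN1 subrr.
have : lorentz h (w + lorentz w q *: q) = 0.
  apply: orthLW; split=> //=.
  - by rewrite rpredD // rpredZ.
  - by rewrite rpredD // rpredZ.
  - by rewrite lorentzDl lorentzZl qq mulrN1 subrr.
by rewrite lorentzDr lorentzZr hq0 mulr0 addr0.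
Qed.

(** Outside the plane, the geodesic through [p] and [q] is the one spanned by
    these two vectors, and its tangent vectors at [q] are the multiples of
    [p + lorentz p q *: q]. *)
Lemma perp_foot_of_projection W p q : hyperbolic_space p -> hplane W q ->
  orthogonal_to W (p + lorentz p q *: q) -> exists q', is_perp_foot W p q'.
Proof.
move=> hp [hq Wq] orthW; have [Wp|WpN] := pselect (p \in W).
  by exists p; left; split.
exists q; right; split=> [[]//|].
have qq : lorentz q q = -1 by case: hq.
have qN0 : q != 0.
  by apply/eqP => q0; move: qq; rewrite q0 lorentz0l; lra.
exists (<[p]> + <[q]>)%VS.
have Lp : p \in (<[p]> + <[q]>)%VS.
  by rewrite (subvP (addvSl _ _)) ?memv_line.
have Lq : q \in (<[p]> + <[q]>)%VS.
  by rewrite (subvP (addvSr _ _)) ?memv_line.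
split=> //.
- have pN0 : p != 0 by apply/eqP => p0; apply: WpN; rewrite p0 mem0v.
  rewrite dimv_disjoint_sum ?dim_vline ?pN0 ?qN0 //.
  apply/eqP; rewrite -subv0; apply/subvP => u; rewrite memv_cap memv0.
  case/andP => /vlineP[a ->] /vlineP[b apbq].
  have [->|aN0] := eqVneq a 0; first by rewrite scale0r.
  case: WpN; rewrite -(scale1r p) -(mulVf aN0) -scalerA apbq.
  by rewrite !rpredZ.
- by exists p => //; case: hp => -> _; rewrite ltrN10.
split=> // u w [/memv_addP[_ /vlineP[a ->] [_ /vlineP[b ->] ->]] /= uq] [Ww _].
have bE : b = a * lorentz p q.
  by move: uq; rewrite lorentzDl !lorentzZl qq; lra.
by rewrite bE -scalerA -scalerDr lorentzZl orthW // mulr0.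
Qed.

(** The point [p1] makes [W] time-like: this gives that [h] is space-like, so that
    [p - h] can be scaled to a point of the hyperboloid, and that [W] meets its
    orthogonal complement trivially, so that the orthogonal part of [p] computed
    from any foot equals [h]. *)
Lemma cosh_dist_plane W p p1 h : hyperbolic_space p -> hplane W p1 ->
  p - h \in W -> orthogonal_to W h ->
  cosh (dist_plane p W) = Num.sqrt (1 + lorentz p h).
Proof.
move=> hp [[p1p1 _] Wp1] Wg orthh.
have p1_neg : lorentz p1 p1 < 0 by rewrite p1p1 ltrN10.
have pp : lorentz p p = -1 by case: hp.
have ph : lorentz p h = lorentz h h.
  by apply/eqP; rewrite -subr_eq0 -lorentzBl lorentzC orthh.
have hh_ge0 : 0 <= lorentz h h.
  have [->|hN0] := eqVneq h 0; first by rewrite lorentz0l.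
  by rewrite ltW // (lorentz_orthogonal_gt0 p1) // orthh.
(* The foot is the projection [p - h] divided by the square root of minus its
   Lorentz square. *)
have exfoot : exists q, is_perp_foot W p q.
  set r := Num.sqrt (1 + lorentz h h).
  have rr : r ^+ 2 = 1 + lorentz h h by rewrite sqr_sqrtr //; lra.
  have r_gt0 : 0 < r by rewrite sqrtr_gt0; lra.
  have rN0 : r != 0 by rewrite gt_eqF.
  set g := p - h in Wg.
  have pg : lorentz p g = - r ^+ 2 by rewrite lorentzBr pp ph rr; ring.
  have gg : lorentz g g = - r ^+ 2.
    by rewrite {1}/g lorentzBl pg orthh // subr0.
  have pq : lorentz p (r^-1 *: g) = - r.
    by rewrite lorentzZr pg; field.
  apply: (perp_foot_of_projection W p (r^-1 *: g)) => //.
    split; last by rewrite /= rpredZ.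
    apply: (hyperbolic_space_orientation p) => //.
      by rewrite lorentzZl lorentzZr gg; field.
    by rewrite pq oppr_lt0.
  rewrite pq scalerA mulNr divff // scaleN1r /g opprB addrC subrK.
  exact: orthh.
have footq : is_perp_foot W p (perp_foot W p).
  by case: exfoot => q fq; exact: (xgetPex p (ex_intro _ q fq)).
rewrite /dist_plane; move: (perp_foot W p) footq => q footq.
have [[hq Wq] orthq] := perp_foot_orthogonal _ _ _ hp footq.
have pq_le := lorentz_hyperbolic_le _ _ hp hq.
rewrite /hdist arccoshK; last lra.
(* Both sides are orthogonal parts of [p], so their difference lies in [W] and
   is orthogonal to it. *)
have hE : p + lorentz p q *: q = h.
  apply/eqP; rewrite -subr_eq0; set d := _ - h.
  have Wd : d \in W by rewrite /d addrAC rpredD // rpredZ.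
  have orthd w : w \in W -> lorentz d w = 0.
    by move=> Ww; rewrite lorentzBl orthq // orthh // subrr.
  apply: contraTT isT => dN0.
  by have := lorentz_orthogonal_gt0 _ _ p1_neg (orthd _ Wp1) dN0; rewrite orthd ?ltxx.
rewrite -hE lorentzDr lorentzZr pp addrA subrr add0r -expr2 -sqrrN sqrtr_sqr.
by rewrite ger0_norm //; lra.
Qed.

(** * Gram matrices of the Lorentz form *)

Lemma lorentz_mulmx (m : nat) (A B : 'I_m -> V) :
  \matrix_(i, j) lorentz (A i) (B j) =
  \matrix_i A i *m diag_mx (\row_i (if i == ord0 then -1 else 1))
    *m (\matrix_i B i)^T.
Proof.
apply/matrixP => i j; rewrite mul_mx_diag !mxE [RHS](bigD1 ord0) //= !mxE.
rewrite eqxx mulrN1 mulNr; congr (_ + _).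
by apply: eq_bigr => l /negPf lN0; rewrite !mxE lN0 mulr1.
Qed.

(** Subtracting from the last row of a Gram matrix the combination [y] of the
    other rows replaces [A ord_max] by [h].  If [h] is orthogonal to every [B] but
    the last, only one entry of that row survives. *)
Lemma bordered_gram_det (k : nat) (A B : 'I_k.+2 -> V) (y : 'I_k.+1 -> R) h :
  h = A ord_max - \sum_a y a *: A (lift ord_max a) ->
  (forall b, lorentz h (B (lift ord_max b)) = 0) ->
  \det (\matrix_(a, b) lorentz (A a) (B b)) =
  \det (\matrix_(a, b) lorentz (A (lift ord_max a)) (B (lift ord_max b)))
    * lorentz h (B ord_max).
Proof.
move=> hE hB0.
have liftN (a : 'I_k.+1) : (lift ord_max a == ord_max) = false.
  by rewrite eq_sym (negPf (neq_lift _ _)).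
(* The unitriangular matrix of the row operation. *)
pose U : 'M[R]_k.+2 := \matrix_(a, b)
  if a == ord_max then oapp (fun c => - y c) 1 (unlift ord_max b)
  else (a == b)%:R.
have detU : \det U = 1.
  rewrite det_trig; last first.
    apply/is_trig_mxP => a b ab; rewrite mxE.
    case: eqP => [aE|_]; first by move: ab; rewrite aE ltnNge -ltnS ltn_ord.
    by case: eqP => // aE; rewrite aE ltnn in ab.
  by apply: big1 => a _; rewrite mxE eqxx; case: eqP => // ->; rewrite unlift_none.
rewrite -[LHS]mul1r -detU -det_mulmx (expand_det_row _ ord_max).
have hrow b : (U *m \matrix_(a, b) lorentz (A a) (B b)) ord_max b = lorentz h (B b).
  rewrite mxE (bigD1_ord ord_max) //= !mxE eqxx unlift_none /= mul1r hE lorentzBl.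
  congr (_ + _); rewrite lorentz_suml -sumrN; apply: eq_bigr => a _.
  by rewrite !mxE eqxx liftK /= lorentzZl mulNr.
rewrite (bigD1_ord ord_max) //= [X in _ + X]big1 => [|b _].
  rewrite addr0 hrow mulrC; congr (_ * _).
  rewrite /cofactor addnn -mul2n exprM sqrrN expr1n expr1n mul1r.
  congr (\det _); apply/matrixP => a b; rewrite !mxE.
  rewrite (bigD1 (lift ord_max a)) //= big1 => [|c /negPf caN]; rewrite !mxE liftN.
    by rewrite eqxx mul1r addr0.
  by rewrite eq_sym caN mul0r.
by rewrite hrow hB0 mul0r.
Qed.

End Lorentz.

Arguments orthogonal_to {R n} W h.

(** * Determinants attached to a simplex *)

Section Simplex.
Variables (R : realType) (n : nat).
Local Notation V := 'rV[R]_n.+1.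
Variable v : 'I_n.+1 -> V.
Hypothesis hv : hsimplex v.
Local Notation M := (edge_matrix v).

Let v_neg i : lorentz (v i) (v i) < 0.
Proof. by case: hv => /(_ i)[-> _] _; rewrite ltrN10. Qed.

Lemma det_edge_matrix_lt0 : \det M < 0.
Proof.
rewrite /edge_matrix lorentz_mulmx !det_mulmx det_tr det_diag.
have -> : \prod_i (\row_i (if i == ord0 then -1 else 1) : V) 0 i = -1.
  rewrite (bigD1 ord0) //= mxE eqxx big1 ?mulr1 // => i /negPf iN0.
  by rewrite mxE iN0.
have : \det (\matrix_i v i) != 0.
  by case: hv => _; rewrite row_free_unit unitmxE unitfE.
set d := \det _ => dN0.
by rewrite mulrN1 mulNr oppr_lt0 -expr2 lt0r sqrf_eq0 dN0 sqr_ge0.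
Qed.

(** The outer normal before normalisation; up to the factor [\det M] these vectors
    form the dual basis of the vertices. *)
Definition dual_vector (s : 'I_n.+1) : V := \sum_j cofactor M s j *: v j.

Lemma lorentz_dual s i : lorentz (dual_vector s) (v i) = \det M *+ (i == s).
Proof.
have := congr1 (fun A : 'M[R]_n.+1 => A i s) (mul_mx_adj M); rewrite !mxE => <-.
rewrite lorentz_suml; by apply: eq_bigr => j _; rewrite !mxE lorentzZl mulrC lorentzC.
Qed.

(** This product is the Lorentz square of the dual vector of [s], which is
    orthogonal to any other vertex; there is one because [n] is positive. *)
Lemma cofactor_mul_det_gt0 s : (0 < n)%N -> 0 < cofactor M s s * \det M.
Proof.
move=> n0.
have -> : cofactor M s s * \det M = lorentz (dual_vector s) (dual_vector s).
  rewrite {2}/dual_vector lorentz_sumr (bigD1 s) //= lorentzZr lorentz_dual eqxx.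
  rewrite big1 ?addr0 // => j /negPf jNs.
  by rewrite lorentzZr lorentz_dual jNs mulr0.
have lsN : (lift s (Ordinal n0) == s) = false.
  by rewrite eq_sym (negPf (neq_lift _ _)).
apply: (lorentz_orthogonal_gt0 _ _ (v (lift s (Ordinal n0)))) => //.
  by rewrite lorentz_dual lsN.
apply/eqP => d0; have := lorentz_dual s s.
by rewrite d0 lorentz0l eqxx mulr1n => dM0; move: det_edge_matrix_lt0; rewrite -dM0 ltxx.
Qed.

Lemma dual_vector_expansion p :
  p = \sum_s (lorentz (dual_vector s) p / \det M) *: v s.
Proof.
have Pu : \matrix_i v i \in unitmx by case: hv => _; rewrite row_free_unit.
have [x ->] : exists x : 'I_n.+1 -> R, p = \sum_s x s *: v s.
  exists (fun s => (p *m invmx (\matrix_i v i)) 0 s).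
  rewrite -[LHS](mulmxKV Pu) mulmx_sum_row.
  by apply: eq_bigr => s _; rewrite rowK.
apply: eq_bigr => s _; congr (_ *: _).
rewrite lorentz_sumr (bigD1 s) //= lorentzZr lorentz_dual eqxx big1.
  by rewrite addr0 mulfK // lt_eqF // det_edge_matrix_lt0.
by move=> i /negPf iNs; rewrite lorentzZr lorentz_dual iNs mulr0.
Qed.

Variable k : nat.
Hypothesis hk : (k < n)%N.

Let w (a : 'I_k.+1) : V := v (inord a).

Lemma val_inord_face (a : 'I_k.+1) : (inord a : 'I_n.+1) = a :> nat.
Proof. by rewrite inordK // (leq_trans (ltn_ord a)) // ltnW. Qed.

(** A combination [u] of the vertices of the face orthogonal to all of them is
    orthogonal to itself and to a time-like vertex, hence zero; the dual vectors
    then read off that its coefficients vanish. *)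
Lemma leading_minor_neq0 : leading_minor M k != 0.
Proof.
rewrite /leading_minor -unitfE -unitmxE -row_free_unit -kermx_eq0.
apply/rowV0P => x /sub_kermxP xG0.
pose u := \sum_a x 0 a *: w a.
have uw b : lorentz u (w b) = 0.
  have := congr1 (fun y : 'rV_k.+1 => y 0 b) xG0; rewrite !mxE => <-.
  by rewrite lorentz_suml; apply: eq_bigr => a _; rewrite !mxE lorentzZl.
have u0 : u = 0.
  apply: contraTeq isT => uN0.
  have := lorentz_orthogonal_gt0 _ _ (w ord0) u (v_neg _) (uw _) uN0.
  rewrite {2}/u lorentz_sumr big1 ?ltxx // => a _.
  by rewrite lorentzZr uw mulr0.
apply/rowP => a; rewrite mxE; apply/eqP.
have : lorentz (dual_vector (inord a)) u = 0 by rewrite u0 lorentzC lorentz0l.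
rewrite lorentz_sumr (bigD1 a) //= lorentzZr lorentz_dual eqxx big1 => [|b bNa].
  by rewrite addr0 => /eqP; rewrite mulf_eq0 (lt_eqF det_edge_matrix_lt0) orbF.
rewrite lorentzZr lorentz_dual -val_eqE /= !val_inord_face val_eqE (negPf bNa).
by rewrite mulr0.
Qed.

Lemma orthogonal_to_face h :
  (forall a, lorentz h (w a) = 0) -> orthogonal_to (face_span v k) h.
Proof.
move=> hw _ /memv_sumP[us usP ->]; rewrite lorentz_sumr big1 // => i ik.
have /vlineP[c ->] := usP i ik; rewrite lorentzZr.
have -> : v i = w (Ordinal (ik : (i < k.+1)%N)) by rewrite /w /= inord_val.
by rewrite hw mulr0.
Qed.

Lemma vertex_in_face (i : 'I_n.+1) : (i <= k)%N -> v i \in face_span v k.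
Proof. by move=> ik; rewrite (subvP (sumv_sup i ik (subvv _))) ?memv_line. Qed.

(** The coefficients of the orthogonal projection solve a linear system whose
    matrix is the Gram matrix of the face. *)
Lemma face_projection u :
  exists y : 'I_k.+1 -> R, forall b, lorentz (u - \sum_a y a *: w a) (w b) = 0.
Proof.
pose G : 'M[R]_k.+1 := \matrix_(a, b) M (inord a) (inord b).
have Gu : G \in unitmx by rewrite unitmxE unitfE; exact: leading_minor_neq0.
pose r : 'rV[R]_k.+1 := \row_b lorentz u (w b).
exists (fun a => (r *m invmx G) 0 a) => b; apply/eqP.
rewrite lorentzBl subr_eq0 lorentz_suml; apply/eqP.
have := congr1 (fun y : 'rV_k.+1 => y 0 b) (mulmxKV Gu r); rewrite !mxE => <-.
by apply: eq_bigr => a _; rewrite lorentzZl !mxE.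
Qed.

(** Schur complement: the bordered minor divided by the leading minor is the
    Lorentz product of the parts of the two vertices orthogonal to the face; as
    [h] is orthogonal to the face, [v s] may stand for its orthogonal part. *)
Lemma bordered_minor_proj t s (y : 'I_k.+1 -> R) (h := v t - \sum_a y a *: w a) :
  (forall b, lorentz h (w b) = 0) ->
  bordered_minor M k t s = leading_minor M k * lorentz h (v s).
Proof.
have bmax i : @border n k i ord_max = i by rewrite /border /= ltnn.
have bwid i (a : 'I_k.+1) :
    @border n k i (lift ord_max a) = inord a.
  by rewrite /border lift_max -ltnS ltn_ord.
move=> hw.
have -> : bordered_minor M k t s =
    \det (\matrix_(a, b) lorentz (v (@border n k t a)) (v (@border n k s b))).
  by congr (\det _); apply/matrixP => a b; rewrite !mxE.
rewrite (bordered_gram_det _ _ _ (v \o @border n k t) (v \o border s) y h) /=.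
- rewrite bmax; congr (_ * _); congr (\det _).
  by apply/matrixP => a b; rewrite !mxE !bwid.
- by rewrite bmax; congr (_ - _); apply: eq_bigr => a _; rewrite bwid.
- by move=> b; rewrite bwid hw.
Qed.

End Simplex.

Arguments dual_vector {R n} v s.

(** * The distance formula *)

Theorem theorem2p2 (R : realType) (n k : nat) (hk : (k < n)%N)
    (v : 'I_n.+1 -> 'rV[R]_n.+1) (hv : hsimplex v)
    (p : 'rV[R]_n.+1) (hp : hyperbolic_space p) :
  let M := edge_matrix v in
  let e := outer_normal v in
  cosh (dist_plane p (face_span v k)) =
  Num.sqrt (1 - \sum_(s < n.+1 | (k < s)%N) \sum_(t < n.+1 | (k < t)%N)
    Num.sqrt (cofactor M s s * cofactor M t t) * bordered_minor M k t s
      * lorentz p (e t) * lorentz p (e s)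
      / (\det M * leading_minor M k)).
Proof.
move=> M e.
have n_gt0 : (0 < n)%N by apply: leq_ltn_trans hk.
have D_lt0 : \det M < 0 := det_edge_matrix_lt0 _ _ _ hv.
have mN0 : leading_minor M k != 0 := leading_minor_neq0 _ _ _ hv _ hk.
set D := \det M in D_lt0 *; set m := leading_minor M k in mN0 *.
have DN0 : D != 0 by rewrite lt_eqF.
pose x s := lorentz (dual_vector v s) p / D.
have pE : p = \sum_s x s *: v s := dual_vector_expansion _ _ _ hv p.
have /boolp.choice[y yP] := fun t => face_projection _ _ _ hv _ hk (v t).
pose h_ t := v t - \sum_a y t a *: v (inord a).
have h_W t : orthogonal_to (face_span v k) (h_ t).
  by apply: orthogonal_to_face; exact: yP.
pose h := \sum_(t < n.+1 | (k < t)%N) x t *: h_ t.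
have hW : orthogonal_to (face_span v k) h.
  move=> u Wu; rewrite lorentz_suml big1 // => t _.
  by rewrite lorentzZl h_W ?mulr0.
have Wph : p - h \in face_span v k.
  rewrite {1}pE (bigID (fun s : 'I_n.+1 => (k < s)%N)) /= addrAC rpredD //.
    rewrite /h -sumrB rpred_sum // => t _.
    rewrite -scalerBr rpredZ // /h_ subKr rpred_sum // => a _.
    by rewrite rpredZ // vertex_in_face // val_inord_face // -ltnS ltn_ord.
  by rewrite rpred_sum // => s; rewrite -leqNgt => sk; rewrite rpredZ // vertex_in_face.
have hv0 : hplane (face_span v k) (v ord0).
  by split; [case: hv => /(_ ord0)|rewrite /= vertex_in_face].
rewrite (cosh_dist_plane _ _ _ p _ h hp hv0 Wph hW); congr (Num.sqrt (_ + _)).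
(* The normalisations of the two outer normals multiply to [- D] times the square
   root in the numerator, because [D] is negative. *)
have term s t : Num.sqrt (cofactor M s s * cofactor M t t)
    * bordered_minor M k t s * lorentz p (e t) * lorentz p (e s) / (D * m) =
    - (x s * (x t * lorentz (h_ t) (v s))).
  rewrite (bordered_minor_proj _ _ _ _ t s (y t)); last exact: yP.
  have eE i : lorentz p (e i) = D * x i / Num.sqrt (cofactor M i i * D).
    by rewrite lorentzZr lorentzC mulrC /x [D * _]mulrC divfK.
  rewrite !eE -/m -/M -/(h_ t).
  have Ms0 := cofactor_mul_det_gt0 _ _ _ hv s n_gt0.
  have Mt0 := cofactor_mul_det_gt0 _ _ _ hv t n_gt0.
  rewrite -/M -/D in Ms0 Mt0.
  have : Num.sqrt (cofactor M s s * D) * Num.sqrt (cofactor M t t * D) =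
      - D * Num.sqrt (cofactor M s s * cofactor M t t).
    rewrite -sqrtrM ?ltW // mulrACA mulrC -expr2 sqrtrM ?sqr_ge0 //.
    by rewrite sqrtr_sqr ltr0_norm.
  have : Num.sqrt (cofactor M s s * D) != 0 by rewrite gt_eqF ?sqrtr_gt0.
  have : Num.sqrt (cofactor M t t * D) != 0 by rewrite gt_eqF ?sqrtr_gt0.
  move: (Num.sqrt (cofactor M s s * D)) (Num.sqrt (cofactor M t t * D)) => a b.
  move: (Num.sqrt _) => c bN0 aN0 abE.
  have -> : c = - (a * b) / D by rewrite abE; field.
  by field; rewrite aN0 bN0 DN0 mN0.
(* Only the coordinates of [p] outside the face contribute to [lorentz p h]. *)
rewrite (eq_bigr (fun s => - (x s * lorentz h (v s)))) => [|s _].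
  rewrite sumrN opprK {1}pE lorentzC lorentz_sumr.
  rewrite [LHS](bigID (fun s : 'I_n.+1 => (k < s)%N)) /= [X in _ + X]big1.
    by rewrite addr0; apply: eq_bigr => s _; rewrite lorentzZr.
  by move=> s; rewrite -leqNgt => sk; rewrite lorentzZr hW ?mulr0 ?vertex_in_face.
under eq_bigr do rewrite term.
rewrite sumrN -mulr_sumr /h lorentz_suml; congr (- (_ * _)).
by apply: eq_bigr => t _; rewrite lorentzZl.
Qed.
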